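(* Let $Y=(Y(x):x\ge 0)$ be a real-valued Markov process and let $0<a<b<\infty$. Then for every history $H\in\mathcal{H}$ and every $T>0$, $$V_2(H,T)\le V_1(H,T)\le\inf_{\lambda>0}\bigl(V(H,\lambda)+\lambda T\bigr).$$
   Context: **Histories.** $\mathcal{H}=\bigcup_{T=0}^\infty(\mathbb{R}_+\times\mathbb{R})^T$ is the space of histories. A history is regarded as a finite (unordered) set of pairs $(x,y)$, where $(x,y)$ records the observation $Y(x)=y$. Conditioning on $H\in\mathcal{H}$ means conditioning on $Y(x)=y$ for all $(x,y)\in H$. **Policies.** A (deterministic) policy is a measurable function $\pi:\mathcal{H}\to\mathbb{R}_+\cup\{\Delta\}$; $\Delta$ means ''stop''. $\Pi$ is the set of all such policies. A randomized policy is a measurable function $\pi:[0,1]\times\mathcal{H}\to\mathbb{R}_+\cup\{\Delta\}$; $\Pi_R$ is the set of all randomized policies. (Deterministic policies are viewed as randomized policies not depending on the first argument.) Starting from an initial history $H_0$, a policy generates $x_{t+1}=\pi(H_t)$ (deterministic) or $x_{t+1}=\pi(U,H_t)$ (randomized), where $U\sim\mathrm{Uniform}([0,1])$ is drawn once at time $0$, independently of $Y$, and held fixed over time. Then $H_{t+1}=H_t\cup\{(x_{t+1},Y(x_{t+1}))\}$ if $x_{t+1}\neq\Delta$ and $H_{t+1}=H_t$ if $x_{t+1}=\Delta$ (sampling a point already in the history leaves the history unchanged). The number of samples $\tau$ is the first $t\ge 0$ at which the policy's decision based on $H_t$ is $\Delta$ ($\infty$ if there is none). $\mathbb{P}^\pi(\cdot\mid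 H)$ and $\mathbb{E}^\pi[\cdot\mid H]$ denote the law and expectation under policy $\pi$ started from initial history $H_0=H$. **Reward.** $I$ is a finite index set, and for $i\in I$, $f_i:\mathbb{R}\to\mathbb{R}$ is a bounded measurable function with $\int_{[a,b]}\mathbb{E}[|f_i(Y(x))|]\,dx<\infty$. For $H\in\mathcal{H}$, $$R_{[a,b]}(H)=\int_{[a,b]}\max_{i\in I}\mathbb{E}[f_i(Y(x))\mid H]\,dx.$$ **Value functions.** For $\lambda>0$, the cost-per-sample value is $$V(H,\lambda)=\sup_{\pi\in\Pi}\mathbb{E}^\pi[R_{[a,b]}(H_\tau)-\lambda\tau\mid H],$$ where a policy with $\mathbb{P}^\pi(\tau=\infty\mid H)>0$ has value $-\infty$ at $H$. With $$\Pi_1(H,T)=\{\pi\in\Pi_R:\mathbb{E}^\pi[\tau\mid H]=T\},\qquad \Pi_2(H,T)=\{\pi\in\Pi_R:\mathbb{P}^\pi(\tau=T\mid H)=1\},$$ the expected-budget-constrained and budget-constrained values are $$V_j(H,T)=\sup_{\pi\in\Pi_j(H,T)}\mathbb{E}^\pi[R_{[a,b]}(H_\tau)\mid H],\qquad j=1,2$$ (with $\sup\emptyset=-\infty$). *)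

(* Defs.v *)
From HB Require Import structures.
From mathcomp Require Import all_boot all_order all_algebra.
From mathcomp Require Import finmap.
From mathcomp Require Import all_classical all_reals all_analysis.
From mathcomp Require Import measurable_realfun.

Set Implicit Arguments.
Unset Strict Implicit.
Unset Printing Implicit Defensive.

Set Warnings "-redundant-canonical-projection".

Import Order.TTheory GRing.Theory Num.Theory.
Import numFieldNormedType.Exports.

Local Open Scope classical_set_scope.
Local Open Scope ring_scope.

(* The half-line [0, +oo[, with the trace of the Borel sigma-algebra. *)
Definition Rplus (R : realType) : Type := {nonneg R}.

HB.instance Definition _ (R : realType) := Choice.on (Rplus R).
HB.instance Definition _ (R : realType) :=
  isPointed.Build (Rplus R) (0%:nng : {nonneg R}).

Definition Rplus_val (R : realType) (x : Rplus R) : R := (x : {nonneg R})%:num.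

HB.instance Definition _ (R : realType) := Measurable.copy (Rplus R)
  (g_sigma_algebra_preimageType (@Rplus_val R)).

(* The point x of the half-line; the value for x < 0 is junk (namely 0). *)
Definition to_Rplus (R : realType) (x : R) : Rplus R :=
  insubd (0%:nng : {nonneg R}) x.

(* [option T] is the disjoint union of T and of the atom None; in the codomain
   of a policy, None stands for the decision to stop. *)
Section option_measurable.
Context {d : measure_display} {T : measurableType d}.

Definition option_measurable : set (set (option T)) :=
  [set A | measurable (Some @^-1` A)].

Let option_measurable0 : option_measurable set0.
Proof. by rewrite /option_measurable /= preimage_set0. Qed.

Let option_measurableC A : option_measurable A -> option_measurable (~` A).
Proof. by move=> mA; exact: measurableC. Qed.

Let option_measurable_bigcup (F : (set (option T))^nat) :
  (forall i, option_measurable (F i)) -> option_measurable (\bigcup_i F i).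
Proof.
move=> mF; rewrite /option_measurable /= preimage_bigcup.
by apply: bigcup_measurable => i _; exact: mF.
Qed.

HB.instance Definition _ := @isMeasurable.Build d (option T) option_measurable
  option_measurable0 option_measurableC option_measurable_bigcup.

End option_measurable.

Definition history (R : realType) : Type := {fset Rplus R * R}.

HB.instance Definition _ (R : realType) := Choice.on (history R).
HB.instance Definition _ (R : realType) := isPointed.Build (history R) fset0.

(* Histories are the n-tuples of observations, for n >= 0, up to order: they
   carry the quotient of the disjoint union of the product sigma-algebras. *)
Section history_measurable.
Context (R : realType).

Definition history_of_tuple n (z : n.-tuple (Rplus R * R)) : history R :=
  [fset p in tval z]%fset.

Definition history_measurable : set (set (history R)) :=
  [set A | forall n, measurable (@history_of_tuple n @^-1` A)].

Let history_measurable0 : history_measurable set0.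
Proof. by move=> n; rewrite preimage_set0. Qed.

Let history_measurableC A : history_measurable A -> history_measurable (~` A).
Proof. by move=> mA n; apply: measurableC (mA n). Qed.

Let history_measurable_bigcup (F : (set (history R))^nat) :
  (forall i, history_measurable (F i)) -> history_measurable (\bigcup_i F i).
Proof.
by move=> mF n; rewrite preimage_bigcup; apply: bigcup_measurable => i _; exact: mF.
Qed.

HB.instance Definition _ :=
  @isMeasurable.Build default_measure_display (history R) history_measurable
    history_measurable0 history_measurableC history_measurable_bigcup.

End history_measurable.

Section process.
Context (R : realType) (d : measure_display) (Omega : measurableType d).
Implicit Types (P : probability Omega R) (Y : Rplus R -> Omega -> R).

Definition measurable_process Y : Prop :=
  measurable_fun [set: Rplus R * Omega] (fun z => Y z.1 z.2).

Definition sigma_process Y (D : set (Rplus R)) : set (set Omega) :=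
  <<s \bigcup_(x in D) g_sigma_algebra_preimage (Y x) >>.

Definition is_cond_prob P (G : set (set Omega)) (A : set Omega)
    (Z : Omega -> \bar R) : Prop :=
  (forall B : set (\bar R), measurable B -> G (Z @^-1` B)) /\
  (forall E, G E -> (\int[P]_(w in E) Z w = P (A `&` E))%E).

(* P(Y t \in B | Y u, u <= s) = P(Y t \in B | Y s) almost surely *)
Definition markov_process P Y : Prop :=
  forall s t : Rplus R, Rplus_val s <= Rplus_val t ->
  forall B : set R, measurable B ->
  exists Z : Omega -> \bar R,
    is_cond_prob P (sigma_process Y [set s]) (Y t @^-1` B) Z /\
    is_cond_prob P (sigma_process Y [set u | Rplus_val u <= Rplus_val s])
      (Y t @^-1` B) Z.

Definition observed Y (X : {fset Rplus R}) (w : Omega) : history R :=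
  [fset (x, Y x w) | x in X]%fset.

(* Q H is a version of the conditional law given Y x = y for all (x, y) in H.
   Such a version is only determined up to null sets of histories, and no
   particular one is singled out. *)
Definition is_cond_law P Y (Q : history R -> probability Omega R) : Prop :=
  (forall A, measurable A -> measurable_fun [set: history R] (fun H => Q H A)) /\
  (forall (X : {fset Rplus R}) A, measurable A ->
    is_cond_prob P (sigma_process Y [set` X]) A (fun w => Q (observed Y X w) A)).

End process.

(* The evolution of the history when the path y is sampled according to pi. *)
Section dynamics.
Context (R : realType) (pi : history R -> option (Rplus R)).
Context (H0 : history R) (y : Rplus R -> R).

(* Sampling a point that is already in the history leaves it unchanged, even
   where y disagrees with the recorded value (almost surely not the case when y
   follows the conditional law given H0). *)
Definition next_history (H : history R) : history R :=
  if pi H is Some x then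
    if x \in [fset p.1 | p in H]%fset then H else ((x, y x) |` H)%fset
  else H.

Definition history_at (t : nat) : history R := iter t next_history H0.

(* The infimum of the empty set is +oo. *)
Definition stop_time : \bar R :=
  ereal_inf [set t%:R%:E | t in [set t | pi (history_at t) = None]].

(* When stop_time = +oo, this is the junk value H0. *)
Definition final_history : history R :=
  history_at (xget 0%N [set t | stop_time = t%:R%:E]).

End dynamics.

(* The domain [0, 1] x T of a function of the randomization U and of T. *)
Definition rand_dom (R : realType) (T : Type) : set (measurableTypeR R * T) :=
  `[0, 1] `*` [set: T].
Arguments rand_dom : clear implicits.

Section values.
Context (R : realType) (d : measure_display) (Omega : measurableType d).
Context (Y : Rplus R -> Omega -> R) (Q : history R -> probability Omega R).
Context (I : finType) (f : I -> R -> R) (a b : R).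
Local Open Scope ereal_scope.

Definition reward (H : history R) : \bar R :=
  \int[lebesgue_measure]_(x in `[a, b])
    \big[maxe/-oo]_(i : I) 'E_(Q H)[fun w => f i (Y (to_Rplus x) w)].

Definition is_policy (pi : history R -> option (Rplus R)) : Prop :=
  measurable_fun [set: history R] pi.

Definition policy_value (H : history R) (lambda : R)
    (pi : history R -> option (Rplus R)) : \bar R :=
  if 0 < Q H [set w | stop_time pi H (Y ^~ w) = +oo] then -oo
  else \int[Q H]_w (reward (final_history pi H (Y ^~ w))
                    - lambda%:E * stop_time pi H (Y ^~ w)).

Definition cost_value (H : history R) (lambda : R) : \bar R :=
  ereal_sup [set policy_value H lambda pi | pi in is_policy].

(* pi u is only used for u in [0, 1]. *)
Definition is_rand_policy (pi : R -> history R -> option (Rplus R)) : Prop :=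
  measurable_fun (rand_dom R (history R)) (fun z => pi z.1 z.2).

(* Joint law of U and of Y given H. *)
Definition rand_law (H : history R) :
    {measure set (measurableTypeR R * Omega) -> \bar R} :=
  uniform_prob (@ltr01 R) \x Q H.

Definition rand_stop_time (H : history R)
    (pi : R -> history R -> option (Rplus R)) (z : R * Omega) : \bar R :=
  stop_time (pi z.1) H (Y ^~ z.2).

Definition rand_reward (H : history R)
    (pi : R -> history R -> option (Rplus R)) : \bar R :=
  \int[rand_law H]_(z in rand_dom R Omega)
    reward (final_history (pi z.1) H (Y ^~ z.2)).

Definition policies1 (H : history R) (T : R) :=
  [set pi | is_rand_policy pi /\
    \int[rand_law H]_(z in rand_dom R Omega) rand_stop_time H pi z = T%:E].

Definition policies2 (H : history R) (T : R) :=
  [set pi | is_rand_policy pi /\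
    rand_law H (rand_dom R Omega `&` [set z | rand_stop_time H pi z = T%:E]) = 1].

Definition budget_value1 (H : history R) (T : R) : \bar R :=
  ereal_sup [set rand_reward H pi | pi in policies1 H T].

Definition budget_value2 (H : history R) (T : R) : \bar R :=
  ereal_sup [set rand_reward H pi | pi in policies2 H T].

End values.

(* Main.v *)
(* Weak Lagrangian duality. Fixing the randomization U = u turns a randomized
   policy into a deterministic one, whose expected value of R - lambda tau is at
   most V(H, lambda); integrating over u and using E[tau] = T gives
   E[R] - lambda T <= V(H, lambda). Tonelli's theorem is applied to the
   nonnegative function C - R + lambda tau, where C bounds R; this requires R and
   tau to be jointly measurable in u and in the path. *)

From HB Require Import structures.
Require Import Defs.
From mathcomp Require Import all_boot all_order all_algebra.
From mathcomp Require Import finmap.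
From mathcomp Require Import all_classical all_reals all_analysis.
From mathcomp Require Import measurable_realfun.
From mathcomp Require Import ring lra.

Set Implicit Arguments.
Unset Strict Implicit.
Unset Printing Implicit Defensive.

Import Order.TTheory GRing.Theory Num.Theory.
Import numFieldNormedType.Exports.

Local Open Scope classical_set_scope.
Local Open Scope ring_scope.

(** * Joint measurability of the controlled histories, the stopping time and the final history *)

Section tuplewise_measurable.
Context {R : realType} {dZ : measure_display} {Z : measurableType dZ}.

(* Inserting a point into a history is not known to be jointly measurable for
   the quotient sigma-algebra of [history R]; it is on tuples. Hence the
   histories reached by a policy are tracked as tuples, piece by piece. *)
Definition tuplewise_measurable (h : Z -> history R) : Prop :=
  exists (J : finType) (F : J -> set Z),
    \bigcup_j F j = setT /\
    forall j, measurable (F j) /\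
      exists n (g : Z -> n.-tuple (Rplus R * R)),
        measurable_fun setT g /\ forall z, F j z -> h z = history_of_tuple (g z).

Lemma tuplewise_measurable_cst (H : history R) :
  tuplewise_measurable (fun=> H).
Proof.
exists unit, (fun=> setT); split; first by apply/seteqP; split => // z _; exists tt.
move=> _; split; first exact: measurableT.
exists (size (enum_fset H)), (fun=> in_tuple (enum_fset H)).
split; first exact: measurable_cst.
by move=> z _; apply/fsetP => p; rewrite /history_of_tuple in_fset.
Qed.

(** On each of the finitely many pieces [h] factors through a measurable tuple, and the
    sigma-algebra of [history R] is by definition the one that [history_of_tuple] pulls back to
    measurable sets for every length. *)
Lemma tuplewise_measurable_fun (h : Z -> history R) :
  tuplewise_measurable h -> measurable_fun setT h.
Proof.
move=> [J [F [FT Fh]]] _ A mA; rewrite setTI.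
have -> : h @^-1` A = \bigcup_j (F j `&` h @^-1` A).
  by rewrite -setI_bigcupl FT setTI.
apply: countable_bigcupT_measurable => [|j].
  exact/finite_set_countable/finite_finset.
have [mF [n [g [mg hg]]]] := Fh j.
have -> : F j `&` h @^-1` A = F j `&` (g @^-1` (@history_of_tuple R n @^-1` A)).
  by apply/seteqP; split => z [Fz]; rewrite /= hg.
apply: measurableI => //; rewrite -[X in measurable X]setTI.
by apply: mg => //; exact: mA.
Qed.

Lemma measurable_Rplus_val : measurable_fun setT (@Rplus_val R).
Proof.
by move=> _ B mB; rewrite setTI; exists B => //; rewrite setTI.
Qed.

Lemma Rplus_val_inj : injective (@Rplus_val R).
Proof. by move=> x y; exact: val_inj. Qed.

Lemma measurable_eq_Rplus (u v : Z -> Rplus R) :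
  measurable_fun setT u -> measurable_fun setT v ->
  measurable [set z | u z = v z].
Proof.
move=> mu mv.
have -> : [set z | u z = v z] =
    setT `&` (fun z => Rplus_val (u z) == Rplus_val (v z)) @^-1` [set true].
  apply/seteqP; split => z /=; first by move=> ->; rewrite eqxx.
  by move=> [_ /eqP/Rplus_val_inj].
apply: measurable_fun_eqr => //; apply: measurableT_comp => //;
  exact: measurable_Rplus_val.
Qed.

(** Measurability in [option T] is tested along [Some] alone, where [odflt t] is the identity. *)
Lemma measurable_odflt {d : measure_display} {T : measurableType d} (t : T) :
  measurable_fun setT (odflt t).
Proof. by move=> _ A mA; rewrite setTI. Qed.

Lemma measurable_is_None {d : measure_display} {T : measurableType d} :
  measurable [set None : option T].
Proof.
rewrite /measurable /= /option_measurable /=.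
by rewrite (_ : _ @^-1` _ = set0) //; apply/seteqP; split.
Qed.

Context (pi : Z -> history R -> option (Rplus R)) (y : Z -> Rplus R -> R).
Hypothesis mpi : measurable_fun setT (fun z => pi z.1 z.2).
Hypothesis my : measurable_fun setT (fun z => y z.1 z.2).

Lemma measurable_decision (h : Z -> history R) :
  measurable_fun setT h -> measurable_fun setT (fun z => pi z (h z)).
Proof.
move=> mh; apply: (measurableT_comp mpi (g := fun z => (z, h z))).
exact: measurable_fun_pair.
Qed.

(** Each piece splits in two: where the policy stops or repeats a point, the tuple is kept;
    elsewhere it gains one entry. The index type [J] becomes [J * bool] and stays finite. *)
Lemma tuplewise_measurable_next (h : Z -> history R) :
  tuplewise_measurable h ->
  tuplewise_measurable (fun z => next_history (pi z) (y z) (h z)).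
Proof.
move=> th; have md := measurable_decision (tuplewise_measurable_fun th).
case: th => J [F [FT Fh]].
(* The default [point] only occurs on [N], which is part of the set [S] where the history does not
   change. *)
pose x z : Rplus R := odflt point (pi z (h z)).
have mx : measurable_fun setT x.
  exact: measurableT_comp (measurable_odflt _) md.
pose N := [set z | pi z (h z) = None].
have mN : measurable N.
  by rewrite -[N]setTI; exact: (md measurableT _ measurable_is_None).
pose S := N `|` [set z | x z \in [fset p.1 | p in h z]%fset].
have mFS j : measurable (F j `&` S).
  have [mF [n [g [mg hg]]]] := Fh j.
  (* On [F j], repeating a point is a finite union of coordinate equalities, one for each entry of
     the tuple. *)
  have -> : F j `&` S = F j `&`
      (N `|` \bigcup_(i in [set: 'I_n]) [set z | x z = (tnth (g z) i).1]).
    apply/seteqP; split => z [Fz]; (case => [Nz|]; [by split => //; left|]) => /=.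
      rewrite (hg _ Fz) => /imfsetP[/= p]; rewrite in_fset => /tnthP[i pE] xE.
      by split => //; right; exists i => //=; rewrite xE pE.
    move=> [i _ xi]; split => //; right; rewrite /= (hg _ Fz).
    by apply/imfsetP; exists (tnth (g z) i) => //; rewrite in_fset mem_tnth.
  apply: measurableI => //; apply: measurableU => //.
  apply: fin_bigcup_measurable => [|i _]; first exact: finite_finset.
  apply: measurable_eq_Rplus => //.
  apply: (measurableT_comp measurable_fst).
  by move/measurable_fun_tnthP : mg; exact.
exists (J * bool)%type, (fun jb => F jb.1 `&` if jb.2 then S else ~` S); split.
  apply/seteqP; split => // z _.
  have [j _ Fz] : (\bigcup_j F j) z by rewrite FT.
  by have [Sz|Sz] := pselect (S z); [exists (j, true)|exists (j, false)].
move=> [j b] /=; have [mF [n [g [mg hg]]]] := Fh j; case: b; split => //.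
- exists n, g; split => // z [Fz Sz]; rewrite -hg // /next_history.
  case E : (pi z (h z)) => [x0|//]; case: ifPn => // /negP; case.
  by case: Sz => /=; rewrite /N /x /= E.
(* Measurability has been shown for [F j]&[S], not for [S]; hence the difference is rewritten as
   [F j] minus [F j]&[S]. *)
- by rewrite -setDE -[_ `\` _]set0U -(setDv (F j)) -setDIr; exact: measurableD.
- exists n.+1, (fun z => [tuple of (x z, y z (x z)) :: g z]); split.
    apply: measurable_cons => //; apply: measurable_fun_pair => //.
    apply: (measurableT_comp my (g := fun z => (z, x z))).
    exact: measurable_fun_pair.
  move=> z [Fz] /not_orP[/= Nz xz]; rewrite /next_history.
  move: Nz xz; rewrite /N /x /=; case E : (pi z (h z)) => [x0|//] _ /negP/negbTE -> /=.
  rewrite (hg _ Fz); apply/fsetP => p.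
  by rewrite in_fset1U /history_of_tuple !in_fset inE.
Qed.

Context (H : history R).

Lemma measurable_history_at t :
  measurable_fun setT (fun z => history_at (pi z) H (y z) t).
Proof.
apply: tuplewise_measurable_fun; elim: t => [|t IHt].
  exact: tuplewise_measurable_cst.
exact: tuplewise_measurable_next.
Qed.

Lemma measurable_stop_time :
  measurable_fun setT (fun z => stop_time (pi z) H (y z)).
Proof.
(* Placing [+oo] at the times when the policy continues turns the infimum over stopping times into
   the infimum of a whole sequence of measurable functions. *)
pose u t z : \bar R :=
  if pi z (history_at (pi z) H (y z) t) then +oo%E else t%:R%:E.
have -> : (fun z => stop_time (pi z) H (y z)) = fun z => einfs (u ^~ z) 0%N.
  apply/funext => z; apply/eqP; rewrite eq_le; apply/andP; split.
    apply: le_ereal_inf_tmp => _ [t _ <-]; rewrite /u.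
    case E : (pi z _) => [x|] /=; first exact: leey.
    by apply: ereal_inf_lbound; exists t.
  apply: le_ereal_inf_tmp => _ [t /= E <-].
  by apply: ereal_inf_lbound; exists t => //; rewrite /u E.
apply: measurable_fun_einfs => t; apply: measurable_fun_ifT.
- have md := measurable_decision (measurable_history_at t).
  apply: (measurable_fun_bool false); rewrite setTI.
  rewrite -[X in measurable X]setTI; have := md measurableT _ measurable_is_None.
  congr (measurable (_ `&` _)); apply/seteqP; split => z /=; by case: (pi z _).
- exact: measurable_cst.
- exact: measurable_cst.
Qed.

(** The space is cut along the countably many finite values of the stopping time; on the remaining
    set [xget] returns its default 0, so the final history is the initial one. *)
Lemma measurable_final_history :
  measurable_fun setT (fun z => final_history (pi z) H (y z)).
Proof.
pose S t := [set z | stop_time (pi z) H (y z) = t%:R%:E].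
have mS t : measurable (S t).
  rewrite -[S t]setTI; exact: (measurable_stop_time measurableT (emeasurable_set1 _)).
pose h t z := history_at (pi z) H (y z) t.
have mh t A : measurable A -> measurable (h t @^-1` A).
  by move=> mA; rewrite -[X in measurable X]setTI; exact: measurable_history_at.
have hS t z : S t z -> final_history (pi z) H (y z) = h t z.
  move=> St; rewrite /final_history; congr history_at.
  have [k _ kS|/(_ t)] := xgetP; last by move/(_ St).
  by have /eqP := etrans (esym kS) St; rewrite eqe eqr_nat => /eqP.
have hN z : (~` \bigcup_t S t) z -> final_history (pi z) H (y z) = h 0%N z.
  move=> NS; rewrite /final_history; congr history_at.
  by have [k _ kS|] := xgetP => //; case: NS; exists k.
move=> _ A mA; rewrite setTI.
have -> : (fun z => final_history (pi z) H (y z)) @^-1` A =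
    \bigcup_t (S t `&` h t @^-1` A) `|` (~` (\bigcup_t S t) `&` h 0%N @^-1` A).
  apply/seteqP; split => z /=.
    have [[t _ St]|NS] := pselect ((\bigcup_t S t) z).
      by rewrite (hS _ _ St) => Az; left; exists t.
    by rewrite (hN _ NS) => Az; right.
  move=> [[t _ [St]]|[NS]] /=; first by rewrite (hS _ _ St).
  by rewrite (hN _ NS).
apply: measurableU.
  by apply: bigcup_measurable => t _; apply: measurableI => //; exact: mh.
apply: measurableI; last exact: mh.
by apply: measurableC; exact: bigcup_measurable.
Qed.

End tuplewise_measurable.

Lemma stop_time_ge0 (R : realType) (pi : history R -> option (Rplus R)) H y :
  (0 <= stop_time pi H y)%E.
Proof. by apply: le_ereal_inf_tmp => _ [t _ <-]; rewrite lee_fin. Qed.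

(** * Measurability and bounds for integrals depending on a parameter *)

Section probability_kernel.
Context {d dX : measure_display} {X : measurableType dX} {T : measurableType d}.
Context {R : realType} {Q : X -> probability T R}.
Hypothesis mQ : forall A, measurable A -> measurable_fun setT (fun x => Q x A).

(** An alias of [Q] that takes the measurability proof as an argument, so that the kernel structures
    built from this proof can be attached to it. *)
Definition probability_kernel of
    (forall A, measurable A -> measurable_fun setT (fun x => Q x A)) :
  X -> {measure set T -> \bar R} := Q.

HB.instance Definition _ :=
  @isKernel.Build _ _ X T R (probability_kernel mQ) mQ.

Let probability_kernel_setT x : probability_kernel mQ x setT = 1%E.
Proof. exact: probability_setT. Qed.

HB.instance Definition _ :=
  @Kernel_isProbability.Build _ _ X T R (probability_kernel mQ) probability_kernel_setT.

(** The nonnegative case is the one for finite kernels; a signed integral is by definition the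
    difference of the integrals of the positive and negative parts. *)
Lemma measurable_fun_integral_probability (k : X * T -> \bar R) :
  measurable_fun setT k -> measurable_fun setT (fun x => \int[Q x]_w k (x, w))%E.
Proof.
move=> mk.
have mint (f : X * T -> \bar R) : (forall z, 0 <= f z)%E -> measurable_fun setT f ->
    measurable_fun setT (fun x => \int[Q x]_w f (x, w))%E.
  move=> f0 mf.
  exact: (@measurable_fun_integral_finite_kernel _ _ _ _ _ f (probability_kernel mQ)).
have -> : (fun x => \int[Q x]_w k (x, w))%E =
    (fun x => \int[Q x]_w k^\+ (x, w) - \int[Q x]_w k^\- (x, w))%E.
  by apply/funext => x; rewrite integralE; congr (_ - _)%E; apply: eq_integral => w _;
    rewrite ?funeposE ?funenegE.
apply: emeasurable_funB.
- by apply: (mint k^\+)%E => //; exact: measurable_funepos.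
- by apply: (mint k^\-)%E => //; exact: measurable_funeneg.
Qed.

End probability_kernel.

Section integral_facts.
Context {d d' : measure_display} {T : measurableType d} {T' : measurableType d'}.
Context {R : realType}.
Implicit Types (mu : {sigma_finite_measure set T -> \bar R}).

(** The measurability part of Tonelli's theorem, applied to the positive and negative parts of [k]
    extended by zero off [D]. *)
Lemma measurable_fun_integral_fst mu (D : set T) (k : T * T' -> \bar R) :
  measurable D -> measurable_fun setT k ->
  measurable_fun setT (fun y => \int[mu]_(x in D) k (x, y))%E.
Proof.
move=> mD mk.
have mDT : measurable (D `*` [set: T']) by exact: measurableX.
pose kD := k \_ (D `*` [set: T']).
have mkD : measurable_fun setT kD.
  by apply/(measurable_restrictT _ mDT); exact: measurable_funTS.
have -> : (fun y => \int[mu]_(x in D) k (x, y))%E = fun y => (\int[mu]_x kD (x, y))%E.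
  apply/funext => y; rewrite integral_mkcond; apply: eq_integral => x _.
  by rewrite /kD !patchE in_setX in_setT andbT. 
have -> : (fun y => \int[mu]_x kD (x, y))%E =
    (fun y => \int[mu]_x kD^\+ (x, y) - \int[mu]_x kD^\- (x, y))%E.
  by apply/funext => y; rewrite integralE; congr (_ - _)%E; apply: eq_integral => x _;
    rewrite ?funeposE ?funenegE.
apply: emeasurable_funB.
- apply: (@measurable_fun_fubini_tonelli_G _ _ _ _ _ mu (kD^\+)%E) => //.
  exact: measurable_funepos.
- apply: (@measurable_fun_fubini_tonelli_G _ _ _ _ _ mu (kD^\-)%E) => //.
  exact: measurable_funeneg.
Qed.

Lemma abse_integral_le (mu : {measure set T -> \bar R}) (D : set T)
    (f : T -> \bar R) (M : R) :
  measurable D -> measurable_fun D f -> (0 <= M) ->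
  (forall x, D x -> `|f x| <= M%:E)%E ->
  (`|\int[mu]_(x in D) f x| <= M%:E * mu D)%E.
Proof.
move=> mD mf M0 fM; apply: le_trans (le_abse_integral _ _ _) _ => //.
apply: integral_le_bound => //; exact: aeW.
Qed.

Lemma measurable_fun_bigmaxe (I : Type) (s : seq I) (g : I -> T -> \bar R) :
  (forall i, measurable_fun setT (g i)) ->
  measurable_fun setT (fun x => \big[maxe/-oo]_(i <- s) g i x)%E.
Proof.
move=> mg; elim: s => [|i s IHs].
  by under eq_fun do rewrite big_nil; exact: measurable_cst.
by under eq_fun do rewrite big_cons; exact: measurable_maxe.
Qed.

End integral_facts.

Lemma lee_absl (R : realDomainType) (x y : \bar R) :
  (`|x| <= y)%E = (- y <= x <= y)%E.
Proof.
by case: x y => [x| |] [y| |] //=; rewrite ?lee_fin ?ler_norml ?leey ?leNye.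
Qed.

Lemma measurable_to_Rplus (R : realType) : measurable_fun setT (@to_Rplus R).
Proof.
move=> _ _ [B mB <-]; rewrite !setTI -comp_preimage.
(* Since negative reals are sent to 0, the map read in the reals is the positive part. *)
have -> : @Rplus_val R \o @to_Rplus R = fun x => Num.max x 0.
  apply/funext => x; rewrite /= /Rplus_val /to_Rplus val_insubd /=.
  rewrite /Itv.num_sem num_real /= in_itv /= andbT mulr0z; by case: leP.
rewrite -[X in measurable X]setTI; apply: measurable_maxr => //; exact: measurable_cst.
Qed.

(** * Measurability and boundedness of the reward *)

Section reward_facts.
Context {R : realType} {d : measure_display} {Omega : measurableType d}.
Context {Y : Rplus R -> Omega -> R} {Q : history R -> probability Omega R}.
Context {I : finType} {f : I -> R -> R} {a b : R}.
Hypothesis mY : measurable_process Y.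
Hypothesis mQ : forall A, measurable A -> measurable_fun setT (fun H => Q H A).
Hypothesis mf : forall i, measurable_fun setT (f i).
Local Open Scope ereal_scope.

(** Joint measurability in the point and the history is what makes the reward, an integral over the
    point, measurable in the history. *)
Lemma measurable_expectation_process i :
  measurable_fun setT (fun z : measurableTypeR R * history R =>
    'E_(Q z.2)[fun w => f i (Y (to_Rplus z.1) w)]).
Proof.
have mQ2 A : measurable A ->
    measurable_fun setT (fun z : measurableTypeR R * history R => Q z.2 A).
  by move=> mA; exact: measurableT_comp (mQ mA) measurable_snd.
under eq_fun do rewrite unlock.
apply: (measurable_fun_integral_probability mQ2
  (k := fun z => (f i (Y (to_Rplus z.1.1) z.2))%:E)).
apply/measurable_EFinP; apply: measurableT_comp => //.
apply: (measurableT_comp mY (g := fun z => (to_Rplus z.1.1, z.2))).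
apply: measurable_fun_pair => //=.
apply: measurableT_comp; first exact: measurable_to_Rplus.
exact: measurableT_comp measurable_fst measurable_fst.
Qed.

Lemma measurable_reward : measurable_fun setT (reward Y Q f a b).
Proof.
apply: (@measurable_fun_integral_fst _ _ _ _ _ lebesgue_measure `[a, b]
  (fun z => \big[maxe/-oo]_(i : I) 'E_(Q z.2)[fun w => f i (Y (to_Rplus z.1) w)])).
  exact: measurable_itv.
apply: measurable_fun_bigmaxe => i; exact: measurable_expectation_process.
Qed.

Lemma abse_reward_le (M : R) : (a <= b)%R -> (0 < #|I|)%N ->
  (forall i y, (`|f i y| <= M)%R) ->
  forall H, `|reward Y Q f a b H| <= (M * (b - a))%:E.
Proof.
move=> ab /card_gt0P[i0 _] fM H.
have M0 : (0 <= M)%R by apply: le_trans (fM i0 0%R).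
have EM i x : `|'E_(Q H)[fun w => f i (Y (to_Rplus x) w)]| <= M%:E.
  rewrite unlock -[M%:E]mule1 -[X in _ * X](probability_setT (Q H)).
  apply: abse_integral_le => // [|w _]; last by rewrite lee_fin fM.
  apply/measurable_EFinP; apply: measurableT_comp => //.
  exact: (measurableT_comp mY (pair1_measurable (to_Rplus x))).
have -> : (M * (b - a))%:E = M%:E * lebesgue_measure `[a, b].
  rewrite lebesgue_measure_itv /= lte_fin; case: ltgtP ab => // -> _.
  by rewrite subrr mulr0 mule0.
apply: abse_integral_le => // [|x _].
  apply: measurable_funTS; apply: measurable_fun_bigmaxe => i.
  exact: (measurableT_comp (measurable_expectation_process i) (g := fun x => (x, H))).
rewrite lee_absl; apply/andP; split.
  (* The maximum starts from [-oo], so its lower bound comes from one actual index [i0]. *)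
  apply: (@le_trans _ _ ('E_(Q H)[fun w => f i0 (Y (to_Rplus x) w)])).
    by have := EM i0 x; rewrite lee_absl => /andP[].
  exact: le_bigmax.
apply: bigmax_le; first exact: leNye.
by move=> i _; have := EM i x; rewrite lee_absl => /andP[].
Qed.

(** An empty maximum is [-oo] and the interval has positive length. The reward then has no finite
    bound, so the duality argument does not cover this case. *)
Lemma reward_void : (a < b)%R -> #|I| = 0%N -> forall H, reward Y Q f a b H = -oo.
Proof.
move=> ab /card0_eq I0 H; rewrite /reward.
rewrite (eq_integral (cst -oo)) => [|x _]; last by rewrite big_pred0.
rewrite integral_cst //= lebesgue_measure_itv /= lte_fin ab.
by rewrite gt0_mulNye // lte_fin subr_gt0.
Qed.

End reward_facts.

(** * The Lagrangian of a deterministic policy *)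

Section lagrangian.
Context {R : realType} {d : measure_display} {Omega : measurableType d}.
Context {Y : Rplus R -> Omega -> R} {Q : history R -> probability Omega R}.
Context {I : finType} {f : I -> R -> R} {a b : R}.
Hypothesis mY : measurable_process Y.
Hypothesis mQ : forall A, measurable A -> measurable_fun setT (fun H => Q H A).
Hypothesis mf : forall i, measurable_fun setT (f i).
Local Open Scope ereal_scope.

Let mrew : measurable_fun setT (reward Y Q f a b) := measurable_reward mY mQ mf.

(* The slack of the Lagrangian below the bound C of the reward: it is
   nonnegative, so that Tonelli's theorem needs no integrability. *)
Definition lagrangian_gap (C lambda : R) H (pi : history R -> option (Rplus R))
    (y : Rplus R -> R) : \bar R :=
  C%:E - reward Y Q f a b (final_history pi H y) + lambda%:E * stop_time pi H y.

Context {C lambda : R}.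
Hypothesis reward_le : forall H, `|reward Y Q f a b H| <= C%:E.
Hypothesis lambda_gt0 : (0 < lambda)%R.

Lemma reward_fin_num H : reward Y Q f a b H \is a fin_num.
Proof. by rewrite fin_num_abs (le_lt_trans (reward_le H)) ?ltry. Qed.

Lemma reward_slack_ge0 H : 0 <= C%:E - reward Y Q f a b H.
Proof.
rewrite sube_ge0 ?reward_fin_num //.
by have := reward_le H; rewrite lee_absl => /andP[].
Qed.

Lemma lagrangian_gap_ge0 H pi y : 0 <= lagrangian_gap C lambda H pi y.
Proof.
apply: adde_ge0; first exact: reward_slack_ge0.
by rewrite mule_ge0 ?stop_time_ge0 ?lee_fin ?ltW.
Qed.

Lemma measurable_lagrangian_gap {dZ} {Z : measurableType dZ}
    (pi : Z -> history R -> option (Rplus R)) (y : Z -> Rplus R -> R) H :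
  measurable_fun setT (fun z => pi z.1 z.2) ->
  measurable_fun setT (fun z => y z.1 z.2) ->
  measurable_fun setT (fun z => lagrangian_gap C lambda H (pi z) (y z)).
Proof.
move=> mpi my; apply: emeasurable_funD.
  apply: emeasurable_funB; first exact: measurable_cst.
  by apply: measurableT_comp => //; exact: measurable_final_history.
by apply: measurable_funeM; exact: measurable_stop_time.
Qed.

(** If the gap has infinite integral there is nothing to prove. Otherwise the policy stops almost
    surely, so its value is the genuine expectation, namely [C] minus the integral of the gap. *)
Lemma integral_lagrangian_gap_ge H pi r : is_policy pi ->
  policy_value Y Q f a b H lambda pi <= r%:E ->
  (C - r)%:E <= \int[Q H]_w lagrangian_gap C lambda H pi (Y ^~ w).
Proof.
move=> mpi; pose h w := lagrangian_gap C lambda H pi (Y ^~ w).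
have mpi' : measurable_fun setT (fun z : Omega * history R => pi z.2).
  exact: measurableT_comp mpi measurable_snd.
have my : measurable_fun setT (fun z : Omega * Rplus R => Y z.2 z.1).
  exact: (measurableT_comp mY (measurable_fun_pair measurable_snd measurable_fst)).
have mtau : measurable_fun setT (fun w => stop_time pi H (Y ^~ w)).
  exact: (@measurable_stop_time _ _ _ (fun=> pi) (fun w x => Y x w)).
have mh : measurable_fun setT h.
  exact: (@measurable_lagrangian_gap _ _ (fun=> pi) (fun w x => Y x w)).
have h0 w : 0 <= h w by exact: lagrangian_gap_ge0.
have [ih|] := ltP (\int[Q H]_w h w) +oo; last first.
  by rewrite leye_eq => /eqP -> _; rewrite leey.
have inth : (Q H).-integrable setT h.
  by apply/integrableP; split => //; under eq_integral do rewrite gee0_abs //.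
(* An integrable gap is almost everywhere finite, but it is [+oo] wherever the policy never stops,
   the reward being finite and [lambda] positive. *)
have tau_fin : Q H [set w | stop_time pi H (Y ^~ w) = +oo] = 0.
  apply: measure_negligible.
    rewrite -[X in measurable X]setTI; exact: (mtau measurableT _ (emeasurable_set1 _)).
  apply: negligibleS (integrable_ae measurableT inth) => w /= tauE /(_ Logic.I).
  rewrite /h /lagrangian_gap tauE gt0_muley ?lte_fin //.
  by have := reward_fin_num (final_history pi H (Y ^~ w)); case: (reward _ _ _ _ _ _).
rewrite /policy_value tau_fin ltxx.
rewrite (_ : \int[Q H]_w _ = C%:E - \int[Q H]_w h w).
  have := integrable_fin_num measurableT inth.
  case: (\int[Q H]_w h w) => [x| |] // _; rewrite -!EFinB !lee_fin; lra.
(* The integrands agree at every path: where the stopping time is [+oo], both are [-oo]. *)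
transitivity (\int[Q H]_w (C%:E - h w)).
  apply: eq_integral => w _; rewrite /h /lagrangian_gap.
  have := reward_fin_num (final_history pi H (Y ^~ w)).
  move: (reward _ _ _ _ _ _) => [x| |] // _.
  by case: (_ * _) => [t| |] //=; congr EFin; ring.
rewrite integralB //; last exact: finite_measure_integrable_cst.
by rewrite integral_cst // [X in _ * X - _](probability_setT (Q H)) mule1.
Qed.

End lagrangian.

(** * Randomized policies and the comparison of the two budget constraints *)

Lemma measurable_itv01 (R : realType) :
  measurable (`[0, 1]%classic : set (measurableTypeR R)).
Proof. exact: measurable_itv. Qed.

Lemma uniform_prob01 (R : realType) :
  uniform_prob (@ltr01 R) `[0%R, 1%R]%classic = 1%E.
Proof.
have m01 := @measurable_itv01 R.
rewrite -[LHS]mul1e -integral_cst // integral_mkcond integral_uniform.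
- rewrite subr0 invr1 mul1e -integral_mkcondr setIid integral_cst //=.
  by rewrite lebesgue_measure_itv /= lte_fin ltr01 sube0 mule1.
- by apply/(measurable_restrictT _ m01); exact: measurable_cst.
- by move=> x; rewrite patchE; case: ifP.
Qed.

(* Stopping at once outside [0, 1] makes a randomized policy measurable on the
   whole line, without affecting [rand_dom]. *)
Definition clip_policy (R : realType) (pi : R -> history R -> option (Rplus R))
    (u : R) (h : history R) : option (Rplus R) :=
  if u \in `[0, 1] then pi u h else None.

Section randomized.
Context {R : realType} {d : measure_display} {Omega : measurableType d}.
Context {Y : Rplus R -> Omega -> R} {Q : history R -> probability Omega R}.
Hypothesis mY : measurable_process Y.
Context { pi : R -> history R -> option (Rplus R)} {H : history R}.
Hypothesis mpi : is_rand_policy pi.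

Lemma measurable_rand_dom {d' : measure_display} (T : measurableType d') :
  measurable (rand_dom R T).
Proof. by apply: measurableX => //; exact: measurable_itv01. Qed.

Lemma rand_law_dom : rand_law Q H (rand_dom R Omega) = 1%E.
Proof.
rewrite /rand_law /rand_dom /= (product_measure1E _ _ (@measurable_itv01 R) measurableT).
by rewrite [X in (X * _)%E]uniform_prob01 mul1e; exact: probability_setT.
Qed.

Lemma measurable_clip_policy :
  measurable_fun setT (fun z : measurableTypeR R * history R => clip_policy pi z.1 z.2).
Proof.
have E : [set: measurableTypeR R * history R] `&`
    (fun z => z.1 \in `[0, 1]) @^-1` [set true] = rand_dom R (history R).
  by apply/seteqP; split => -[u h] /= []; rewrite /rand_dom /= => // ? ?; split.
apply: measurable_fun_if => //.
- by apply: (measurable_fun_bool true); rewrite E; exact: measurable_rand_dom.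
- by rewrite E.
Qed.

Lemma clip_policy_is_policy u : is_policy (clip_policy pi u).
Proof. exact: measurableT_comp measurable_clip_policy (pair1_measurable u). Qed.

Lemma measurable_clip_decision : measurable_fun setT
  (fun z : (measurableTypeR R * Omega) * history R => clip_policy pi z.1.1 z.2).
Proof.
apply: (measurableT_comp measurable_clip_policy (g := fun z => (z.1.1, z.2))).
apply: measurable_fun_pair => //=.
exact: measurableT_comp measurable_fst measurable_fst.
Qed.

Lemma measurable_rand_path : measurable_fun setT
  (fun z : (measurableTypeR R * Omega) * Rplus R => Y z.2 z.1.2).
Proof.
apply: (measurableT_comp mY (g := fun z => (z.2, z.1.2))).
apply: measurable_fun_pair => //=.
exact: measurableT_comp measurable_snd measurable_fst.
Qed.

Lemma clip_policyE z : rand_dom R Omega z -> clip_policy pi z.1 = pi z.1.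
Proof. by move=> [/= z01 _]; apply/funext => h; rewrite /clip_policy z01. Qed.

Lemma measurable_clip_stop_time : measurable_fun setT
  (fun z : measurableTypeR R * Omega => stop_time (clip_policy pi z.1) H (Y ^~ z.2)).
Proof.
exact: (@measurable_stop_time _ _ _ (fun z => clip_policy pi z.1) (fun z x => Y x z.2)
  measurable_clip_decision measurable_rand_path).
Qed.

Lemma integral_rand_stop_time :
  (\int[rand_law Q H]_(z in rand_dom R Omega) rand_stop_time Y H pi z =
   \int[rand_law Q H]_(z in rand_dom R Omega)
      stop_time (clip_policy pi z.1) H (Y ^~ z.2))%E.
Proof.
by apply: eq_integral => z /set_mem zD; rewrite /rand_stop_time clip_policyE.
Qed.

End randomized.

(** A stopping time almost surely equal to the constant [T] has expectation [T]. *)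
Lemma policies2_subset_policies1 (R : realType) (d : measure_display)
    (Omega : measurableType d) (Y : Rplus R -> Omega -> R)
    (Q : history R -> probability Omega R) (H : history R) (T : R) :
  measurable_process Y -> policies2 Y Q H T `<=` policies1 Y Q H T.
Proof.
move=> mY pi [mpi pT]; split => //.
have mD := @measurable_rand_dom R _ Omega.
have mtau := measurable_clip_stop_time mY (H := H) mpi.
rewrite integral_rand_stop_time //.
set tau := (fun z => stop_time _ _ _) in mtau *.
set D := rand_dom R Omega in mD pT *.
pose E := D `&` [set z | tau z = T%:E].
have mE : measurable E.
  apply: measurableI => //; rewrite -[X in measurable X]setTI.
  exact: (mtau measurableT _ (emeasurable_set1 _)).
have muE : rand_law Q H E = 1%E.
  rewrite -pT; congr (rand_law Q H _); apply/seteqP; split => z [zD];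
  by rewrite /E /= /tau /rand_stop_time clip_policyE.
rewrite (ae_eq_integral (cst T%:E)) //.
- by rewrite integral_cst // [X in (_ * X)%E]rand_law_dom mule1.
- exact: measurable_funTS.
(* Both [D] and [E] have mass 1, so the exceptional set is null. *)
- exists (D `\` E); split; first exact: measurableD.
    transitivity (rand_law Q H D - rand_law Q H E)%E.
      rewrite -[in RHS](_ : D `&` E = E); last by rewrite setIidr // => z [].
      by apply: measureD => //; rewrite [X in (X < _)%E]rand_law_dom ltry.
    by rewrite muE [X in (X - _)%E]rand_law_dom subee.
  by move=> z /= /not_implyP[zD zT]; split => // -[].
Qed.

(** * Weak duality for randomized policies *)

Section weak_duality.
Context {R : realType} {d : measure_display} {Omega : measurableType d}.
Context {Y : Rplus R -> Omega -> R} {Q : history R -> probability Omega R}.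
Context {I : finType} {f : I -> R -> R} {a b : R}.
Hypothesis mY : measurable_process Y.
Hypothesis mQ : forall A, measurable A -> measurable_fun setT (fun H => Q H A).
Hypothesis mf : forall i, measurable_fun setT (f i).
Local Open Scope ereal_scope.

(** Stated for any real [r] above the cost value, so that it also applies when that value is
    [-oo]. *)
Lemma rand_reward_le (C lambda T r : R) H pi :
  (forall H, `|reward Y Q f a b H| <= C%:E) -> (0 < lambda)%R ->
  cost_value Y Q f a b H lambda <= r%:E ->
  policies1 Y Q H T pi ->
  rand_reward Y Q f a b H pi <= (r + lambda * T)%:E.
Proof.
move=> rew_le l0 Vr [mpi tauT].
(* Still a bound of the reward, enlarged so that the constant [C' - r] is nonnegative and can be
   compared with the inner integrals by monotonicity for nonnegative functions. *)
pose C' := (C + `|r|)%R.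
have rew_le' H' : `|reward Y Q f a b H'| <= C'%:E.
  by apply: le_trans (rew_le H') _; rewrite lee_fin lerDl.
have C0 : (0 <= C)%R by rewrite -lee_fin; exact: le_trans (abse_ge0 _) (rew_le H).
have C'r : (0 <= C' - r)%R by have := ler_norm r; rewrite /C'; lra.
have mD := @measurable_rand_dom R _ Omega.
set D := rand_dom R Omega in mD.
have muD : rand_law Q H D = 1 := rand_law_dom.
have mdec := @measurable_clip_decision _ _ Omega _ mpi.
have mpath := measurable_rand_path mY.
pose tau (z : measurableTypeR R * Omega) := stop_time (clip_policy pi z.1) H (Y ^~ z.2).
pose rew (z : measurableTypeR R * Omega) :=
  reward Y Q f a b (final_history (clip_policy pi z.1) H (Y ^~ z.2)).
pose h (z : measurableTypeR R * Omega) :=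
  lagrangian_gap (Y := Y) (Q := Q) (f := f) (a := a) (b := b) C' lambda H
    (clip_policy pi z.1) (Y ^~ z.2).
have mtau : measurable_fun setT tau := measurable_clip_stop_time mY mpi.
have mrew : measurable_fun setT rew.
  apply: (measurableT_comp (measurable_reward mY mQ mf)).
  exact: (@measurable_final_history _ _ _ (fun z => clip_policy pi z.1)
    (fun z x => Y x z.2) mdec mpath).
have mh : measurable_fun setT h.
  exact: (@measurable_lagrangian_gap _ _ _ _ _ _ _ _ _ mY mQ mf _ _ _ _
    (fun z => clip_policy pi z.1) (fun z x => Y x z.2) H mdec mpath).
have h0 z : 0 <= h z by exact: lagrangian_gap_ge0.
have rewE : rand_reward Y Q f a b H pi = \int[rand_law Q H]_(z in D) rew z.
  by apply: eq_integral => z /set_mem zD; rewrite /rew clip_policyE.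
have rew_int : (rand_law Q H).-integrable D rew.
  apply/integrableP; split; first exact: measurable_funTS.
  apply: (@le_lt_trans _ _ (C%:E * rand_law Q H D)).
    apply: integral_le_bound => //; first exact: measurable_funTS.
    by apply: aeW => z _; exact: rew_le.
  by rewrite muD mule1 ltry.
have cst_int : (rand_law Q H).-integrable D (cst C'%:E).
  apply/integrableP; split => //.
  by rewrite integral_cst // [X in _ * X]muD mule1 ltry.
(* Additivity for nonnegative functions separates the slack from the cost, whose expectation is
   [lambda * T] by the budget constraint; the slack then splits because the reward is integrable. *)
have h_int : \int[rand_law Q H]_(z in D) h z =
    C'%:E - rand_reward Y Q f a b H pi + (lambda * T)%:E.
  rewrite /h /lagrangian_gap ge0_integralD //.
  - rewrite ge0_integralZl // ?lee_fin ?ltW //.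
    + rewrite integralB // integral_cst // muD mule1 -rewE EFinM -tauT.
      by rewrite integral_rand_stop_time.
    + exact: measurable_funTS.
    + by move=> z _; exact: stop_time_ge0.
  - by move=> z _; exact: reward_slack_ge0.
  - by apply: measurable_funTS; apply: emeasurable_funB.
  - by move=> z _; rewrite mule_ge0 ?stop_time_ge0 ?lee_fin ?ltW.
  - by apply: measurable_funTS; apply: measurable_funeM.
have hD0 z : 0 <= (h \_ D) z by rewrite patchE; case: ifP.
have mhD : measurable_fun setT (h \_ D).
  by apply/(measurable_restrictT _ mD); exact: measurable_funTS.
have h_ge : (C' - r)%:E <= \int[rand_law Q H]_(z in D) h z.
  (* After extension by zero off [D], Tonelli's theorem integrates over the path first. The constant
     [C' - r] is cut off to [0, 1], which has uniform mass 1, so outside [0, 1] only nonnegativity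
     is to be checked. *)
  rewrite integral_mkcond /rand_law fubini_tonelli1.
  - rewrite -[leLHS]mule1 -[X in _ * X](uniform_prob01 R).
    rewrite -(integral_cst _ (@measurable_itv01 R)) integral_mkcond.
    apply: ge0_le_integral => //.
    + by move=> u _; rewrite patchE; case: ifP; rewrite ?lee_fin.
    + by apply/(measurable_restrictT _ (@measurable_itv01 R)); exact: measurable_cst.
    + exact: measurable_fun_fubini_tonelli_F.
    + move=> u _; rewrite /fubini_F patchE; case: ifPn => u01; last first.
        by apply: integral_ge0 => w _; exact: hD0.
      rewrite (_ : \int[_]_w _ = \int[Q H]_w h (u, w)); last first.
        apply: eq_integral => w _; rewrite patchE mem_set //.
        by split => //; exact: set_mem u01.
      have mu := clip_policy_is_policy mpi u.
      (* For fixed [u] the clipped policy is one of those in the supremum [cost_value], so its value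
         is at most [r]. *)
      apply: (integral_lagrangian_gap_ge mY mQ mf rew_le' l0 mu).
      apply: le_trans Vr; apply: ereal_sup_ubound.
      by exists (clip_policy pi u).
  - exact: mhD.
  - exact: hD0.
rewrite h_int in h_ge.
have : rand_reward Y Q f a b H pi \is a fin_num.
  by rewrite rewE; exact: integrable_fin_num.
move: h_ge; case: (rand_reward _ _ _ _ _ _ _) => [x| |] // h_ge _.
by move: h_ge; rewrite -EFinB -EFinD !lee_fin; lra.
Qed.

End weak_duality.

Theorem mainTheorem2 (R : realType) (d : measure_display)
    (Omega : measurableType d) (P : probability Omega R)
    (Y : Rplus R -> Omega -> R) (Q : history R -> probability Omega R)
    (I : finType) (f : I -> R -> R) (a b : R)
    (Y_measurable : measurable_process Y)
    (Y_markov : markov_process P Y)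
    (Q_cond : is_cond_law P Y Q)
    (a_gt0 : 0 < a) (a_lt_b : a < b)
    (f_measurable : forall i, measurable_fun setT (f i))
    (f_bounded : forall i, exists M : R, forall y, `|f i y| <= M)
    (f_integrable : forall i,
      (\int[lebesgue_measure]_(x in `[a, b])
         'E_P[fun w => `|f i (Y (to_Rplus x) w)|%R] < +oo)%E) :
  forall (H : history R) (T : R), 0 < T ->
    (budget_value2 Y Q f a b H T <= budget_value1 Y Q f a b H T)%E /\
    (budget_value1 Y Q f a b H T <=
       ereal_inf [set cost_value Y Q f a b H lambda + lambda%:E * T%:E
                 | lambda in [set lambda : R | (0 < lambda)%R]])%E.
Proof.
move=> H T _; have mQ := Q_cond.1; split.
  apply: ereal_sup_le; apply: image_subset.
  exact: policies2_subset_policies1.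
apply: le_ereal_inf_tmp => _ [lambda l0 <-]; apply: ge_ereal_sup => _ [pi pi1 <-].
(* Without indices every reward is [-oo], hence so is its expectation. *)
have [I0|I_gt0] := posnP #|I|.
  rewrite /rand_reward (eq_integral (cst -oo%E)) => [|z _]; last exact: reward_void.
  rewrite integral_cst; last exact: measurable_rand_dom.
  by rewrite [X in (_ * X)%E]rand_law_dom mule1 leNye.
have [M fM] := choice f_bounded.
(* The sum over the finite index set gives one bound common to all [f i]. *)
have fB i y : `|f i y| <= \sum_j `|M j|.
  apply: le_trans (fM i y) _; rewrite (bigD1 i) //=.
  by rewrite (le_trans (ler_norm _)) // lerDl sumr_ge0.
have rew_le := abse_reward_le Y_measurable mQ f_measurable (ltW a_lt_b) I_gt0 fB.
case V : (cost_value Y Q f a b H lambda) => [r| |].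
- by rewrite -EFinM -EFinD; apply: rand_reward_le rew_le l0 _ pi1; rewrite // V.
- by rewrite -EFinM addye // leey.
(* When the cost value is [-oo], the bound at [r - lambda * T] places the reward below every real
   [r]. *)
- rewrite -EFinM addNye leeNy_eq; apply/eqP/eq_ninfty => r.
  rewrite -[r](subrK (lambda * T)).
  by apply: rand_reward_le rew_le l0 _ pi1; rewrite // V leNye.
Qed.
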